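(* Let $p$ be an odd prime, $n\ge 2$ an integer, and $A,k$ integers with $|A|<p/2$, $p\nmid A$, $1\le k<p-1$, $\gcd(k,p-1)=1$. Let $f(x)=Ax^k\bmod p$ (least positive residue) on $I=\{1,\dots,p-1\}$, for $0\le j\le n-1$ let $I_j=\{x:1\le x\le p-1,\ x\equiv j\pmod n\}$, let $d=\gcd(k-1,p-1)$, and let $$\mathscr{C}=\{C\equiv Ax^{k-1}\bmod p:\ 1\le x\le p-1,\ |C|<p/2\}.$$ Suppose $\mathscr{C}$ contains an element $C$ such that $E=C$ or $E=$ the absolutely least residue of $C^{-1}$ mod $p$ satisfies $$E=\frac{tp-r}{s}\quad\text{for integers } t,r,s \text{ with } s>0,\ \gcd(r,s)=1,\ (n+3)s\le |r|\le \frac{p}{n}.$$ If $p>10^6$ and $d\ge 1.32\, n^2p^{1/2}\log^2 p$, or if $k=1$, then $f(I_i)\cap I_j\ne\emptyset$ for all $0\le i,j\le n-1$.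
   Context: $\log$ denotes the natural logarithm; $C^{-1}$ mod $p$ denotes the multiplicative inverse modulo $p$, and its absolutely least residue is the representative of absolute value less than $p/2$. *)

(* Defs.v *)
From mathcomp Require Import all_boot all_order all_algebra.
From mathcomp Require Import all_classical all_reals all_analysis.

Set Implicit Arguments.
Unset Strict Implicit.
Unset Printing Implicit Defensive.

Import Order.TTheory GRing.Theory Num.Theory.

Local Open Scope classical_set_scope.
Local Open Scope ring_scope.

(* [modz] is the least non-negative residue; for p prime not dividing A and
   1 <= x <= p - 1 it is nonzero, hence the least positive residue. *)
Definition power_map (p : nat) (A : int) (k : nat) (x : int) : int :=
  ((A * x ^+ k)%R %% p%:Z)%Z.

Definition residue_class (p n j : nat) : set int :=
  [set x | (1 <= x <= p%:Z - 1) /\ (x = j%:Z %[mod n%:Z])%Z].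

Definition abs_least (p : nat) (c : int) : Prop := `|c|%:Q < p%:Q / 2.

Definition multiplier_set (p : nat) (A : int) (k : nat) : set int :=
  [set C | abs_least p C /\
     exists x : int, (1 <= x <= p%:Z - 1) /\
                     (C = (A * x ^+ (k - 1))%R %[mod p%:Z])%Z].

Definition abs_least_inverse (p : nat) (C E : int) : Prop :=
  abs_least p E /\ ((C * E)%R = 1%R %[mod p%:Z])%Z.

Definition good_fraction (p n : nat) (E : int) : Prop :=
  exists t r s : int,
    [/\ E%:Q = (t * p%:Z - r)%:Q / s%:Q,
        0 < s,
        gcdz r s = 1,
        (n%:Z + 3) * s <= `|r| &
        `|r|%:Q <= p%:Q / n%:Q].

(* Main.v *)
Require Import Defs.
From mathcomp Require Import all_boot all_order all_algebra.
From mathcomp Require Import cyclic finfield.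
From mathcomp Require Import all_classical all_reals all_analysis.
From mathcomp Require Import zify ring lra.

Set Implicit Arguments.
Unset Strict Implicit.
Unset Printing Implicit Defensive.

Import Order.TTheory GRing.Theory Num.Theory.

Local Open Scope ring_scope.

(** On the coset x0 H of the group H of (k-1)-th roots of unity with
    A x0^(k-1) = C, the map f is the linear map x |-> C x. If s E = t p - r, the
    graph of x |-> E x mod p is the set of points of the box (0, p)^2 on the
    lines r x + s y = m p, so the pairs (x, y) of prescribed residues mod n are
    the points of a translate of a lattice in that box.

    Instead of character sums we use an incidence bound: in F_p^2, a set of
    points and a set of non-vertical lines without incidences satisfy
    |P| |L| <= p^3 (second moment). Applied to the points (g, g v) and the lines
    y = - u x + x0 h with g, h in H, it shows that U + V meets x0 H as soon as
    |H|^2 |U| |V| > p^3. As log p >= 12 and 1.32 * 12^2 > 190, it suffices to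
    find U and V with more than p / (190 n^2) elements each, such that U + V
    consists of abscissae of admissible lattice points. Either the lattice has a
    short vector whose multiples form a long enough progression in the box, or
    there is an admissible point with both coordinates in [p/13, 12p/13], to
    which small lattice vectors can be added freely. For k = 1 one admissible
    point is enough. *)

(** * Incidences in the affine plane over a finite field *)

Lemma no_incidence_card (F : finFieldType) (P L : {set F * F}) :
  (forall z l, z \in P -> l \in L -> z.2 != l.1 * z.1 + l.2) ->
  (#|P| * #|L| <= #|F| ^ 3)%N.
Proof.
move=> noinc.
(* A line [l] is coded by its slope [l.1] and intercept [l.2]. *)
pose on (z l : F * F) : int := (l.2 == z.2 - l.1 * z.1)%:R.
have sum_eq (y : F) (f : F -> int) : \sum_b (b == y)%:R * f b = f y.
  rewrite (bigD1 y) //= eqxx mul1r big1 ?addr0 // => b /negPf ->.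
  by rewrite mul0r.
have on1 z : \sum_l on z l = #|F|%:R.
  rewrite -(pair_bigA _ (fun a b => on z (a, b))) /= /on /=.
  have sum1 (y : F) : \sum_b (b == y)%:R = 1 :> int.
    by rewrite -[RHS](sum_eq y (fun=> 1)); apply: eq_bigr => b _; rewrite mulr1.
  by under eq_bigr do rewrite sum1; rewrite sumr_const.
(* Distinct points share at most one line, and none if their abscissae agree; a point lies on [#|F|]
   lines. *)
have on2 z z' : \sum_l on z l * on z' l <= 1 + (z == z')%:R * #|F|%:R.
  rewrite -(pair_bigA _ (fun a b => on z (a, b) * on z' (a, b))) /= /on /=.
  under eq_bigr => a _ do
    rewrite (sum_eq _ (fun b => (b == z'.2 - a * z'.1)%:R)).
  have [<-|nz] := eqVneq z z'.
    by under eq_bigr do rewrite eqxx; rewrite sumr_const mul1r lerDr.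
  rewrite mul0r addr0.
  have [ex|nx] := eqVneq z.1 z'.1.
    rewrite big1 // => a _; case: eqP => // /eqP; rewrite ex (inj_eq (addIr _)).
    by move=> /eqP ey; case/eqP: nz; case: z z' ex ey => [? ?] [? ?] /= -> ->.
  have nx0 : z.1 - z'.1 != 0 by rewrite subr_eq0.
  pose a0 := (z.2 - z'.2) / (z.1 - z'.1).
  rewrite (bigD1 a0) //= big1 ?addr0 ?lern1 ?leq_b1 // => a na.
  case: eqP => // e; case/eqP: na; rewrite /a0; apply: (mulIf nx0).
  rewrite divfK // mulrBr; apply/eqP; rewrite -subr_eq0; apply/eqP.
  by move/eqP: e; rewrite -subr_eq0 => /eqP e; rewrite -[RHS]oppr0 -[in RHS]e; ring.
pose c l := \sum_(z in P) on z l.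
have c1 : \sum_l c l = #|P|%:R * #|F|%:R.
  rewrite exchange_big /=; under eq_bigr do rewrite on1.
  by rewrite sumr_const mulr_natl.
have c2 : \sum_l c l ^+ 2 <= #|P|%:R ^+ 2 + #|P|%:R * #|F|%:R.
  under eq_bigr => l _ do rewrite expr2 big_distrlr /=.
  rewrite exchange_big /=.
  under eq_bigr => z _ do rewrite exchange_big /=.
  apply: (@le_trans _ _ (\sum_(z in P) (#|P|%:R + #|F|%:R))).
    apply: ler_sum => z zP.
    apply: (@le_trans _ _ (\sum_(z' in P) (1 + (z == z')%:R * #|F|%:R))).
      by apply: ler_sum => z' _; apply: on2.
    rewrite big_split /= sumr_const lerD2l (bigD1 z) //= eqxx mul1r big1 ?addr0 //.
    by move=> z' /andP[_ /negPf]; rewrite eq_sym => ->; rewrite mul0r.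
  by rewrite sumr_const -[X in X <= _]mulr_natl mulrDr expr2.
(* Over all lines [c] has mean [#|P| / #|F|]; the deviation is scaled by [#|F|] to stay in the
   integers. *)
have var : \sum_l (#|F|%:R * c l - #|P|%:R) ^+ 2 <= #|P|%:R * #|F|%:R ^+ 3.
  have sqE l : (#|F|%:R * c l - #|P|%:R) ^+ 2 = #|F|%:R ^+ 2 * c l ^+ 2
      - (2 * #|F|%:R * #|P|%:R) * c l + #|P|%:R ^+ 2 by ring.
  under eq_bigr => l _ do rewrite sqE.
  rewrite big_split /= sumrB -!mulr_sumr sumr_const card_prod c1.
  rewrite -[_ *+ (_ * _)]mulr_natl natrM.
  have := ler_wpM2l (sqr_ge0 (#|F|%:R : int)) c2.
  move: (#|F|%:R : int) (#|P|%:R : int) (\sum_l c l ^+ 2) => q m S; lra.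
have [-> //|P0] := posnP #|P|.
(* A line of [L] misses [P], so it alone contributes [#|P| ^ 2] to the variance. *)
have : (#|L|%:R * #|P|%:R ^+ 2 : int) <= #|P|%:R * #|F|%:R ^+ 3.
  apply: le_trans var.
  rewrite [X in _ <= X](bigID (mem L)) /= -[X in X <= _]addr0 lerD //; last first.
    by apply: sumr_ge0 => l _; apply: sqr_ge0.
  rewrite mulr_natl -sumr_const; apply: ler_sum => l lL.
  rewrite /c big1 ?mulr0 ?sub0r ?sqrrN // => z zP; rewrite /on.
  case: eqP => // e; case/eqP: (noinc z l zP lL).
  by rewrite e addrC subrK.
rewrite expr2 mulrCA ler_pM2l ?ltr0n //.
by rewrite -natrX -natrM ler_nat mulnC.
Qed.

(** An incidence [g * v = - u * g + z * x] divided by [g] reads [u + v = z * (x / g)], and [x / g]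
    is in [H]. *)
Lemma sumset_meets_coset (F : finFieldType) (H U V : {set F}) (z : F) :
  z != 0 -> 0 \notin H -> {in H & H, forall g h, g * h \in H} ->
  {in H, forall g, g^-1 \in H} ->
  (#|F| ^ 3 < #|H| ^ 2 * (#|U| * #|V|))%N ->
  exists u v h, [/\ u \in U, v \in V, h \in H & u + v = z * h].
Proof.
move=> z0 H0 HM HV big.
case: (boolP [exists u, exists v, exists h,
   [&& u \in U, v \in V, h \in H & u + v == z * h]]).
  by move=> /existsP[u /existsP[v /existsP[h /and4P[? ? ? /eqP ?]]]]; exists u, v, h.
move=> none; exfalso; move: big; apply/negP; rewrite -leqNgt.
pose f (gv : F * F) := (gv.1, gv.1 * gv.2).
pose h (uh : F * F) := (- uh.1, z * uh.2).
have fP : {in finset.setX H V &, injective f}.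
  move=> [g v] [g' v'] /finset.setXP[gH _] _ [<- /mulfI ->] //.
  by apply: contraNneq H0 => <-.
have hP : injective h by move=> [u x] [u' x'] [/oppr_inj -> /(mulfI z0) ->].
have := @no_incidence_card F [set f x | x in finset.setX H V] [set h x | x in finset.setX U H].
rewrite card_in_imset // card_imset // !cardsX => main.
have -> : (#|H| ^ 2 * (#|U| * #|V|) = #|H| * #|V| * (#|U| * #|H|))%N by ring.
apply: main.
move=> _ _ /imsetP[[g v] /finset.setXP[gH vV] ->] /imsetP[[u x] /finset.setXP[uU xH] ->] /=.
apply: contra none => /eqP e.
have g0 : g != 0 by apply: contraNneq H0 => <-.
apply/existsP; exists u; apply/existsP; exists v; apply/existsP; exists (x * g^-1).
rewrite uU vV HM ?HV //=; apply/eqP; apply: (mulIf g0).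
by rewrite mulrA divfK // mulrDl [v * g]mulrC e; ring.
Qed.

(** * Lattice points on the lines r x + s y = m p *)

Definition lattice_point (p n : nat) (r s i j x y : int) : Prop :=
  [/\ 0 < x < p%:Z, 0 < y < p%:Z, (n%:Z %| x - i)%Z, (n%:Z %| y - j)%Z
    & (p%:Z %| r * x + s * y)%Z].

(** As [p] is invertible mod [n], the admissible levels form one residue class, which meets every
    window of [n] integers. *)
Lemma line_level_exists (p n : nat) (c lo : int) :
  (0 < n)%N -> coprime n p ->
  exists m : int, lo <= m < lo + n%:Z /\ (n%:Z %| m * p%:Z - c)%Z.
Proof.
move=> n0 cop.
have [u [v uv]] := @Bezoutz n%:Z p%:Z.
rewrite /gcdz !absz_nat (eqP cop) in uv.
exists (lo + ((v * c - lo) %% n%:Z)%Z); split; first by lia.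
apply/dvdzP; exists (- ((v * c - lo) %/ n%:Z)%Z * p%:Z - u * c).
have := divz_eq (v * c - lo) n%:Z.
set a := (_ %/ _)%Z; set b := (_ %% _)%Z => e.
have -> : b = v * c - lo - a * n%:Z by lia.
have ce : c = c * (u * n%:Z + v * p%:Z) by rewrite uv mulr1.
lia.
Qed.

(** Solutions with the prescribed residues form a progression of step [n (-s, r)], so [y] can be
    placed in any window of length [r n]. *)
Lemma line_point_exists (n : nat) (r s i j c lo : int) :
  (0 < n)%N -> 0 < r -> gcdz r s = 1 -> (n%:Z %| c - r * i - s * j)%Z ->
  exists x y : int, [/\ r * x + s * y = c, (n%:Z %| x - i)%Z,
    (n%:Z %| y - j)%Z & lo <= y < lo + r * n%:Z].
Proof.
move=> n0 r0 cop /dvdzP[q cq].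
have [u [v uv]] := @Bezoutz r s; rewrite cop in uv.
set w := j + n%:Z * (v * q) - lo.
have := divz_eq w (r * n%:Z).
set a := (_ %/ _)%Z; set b := (_ %% _)%Z => e.
have rn0 : 0 < r * n%:Z by nia.
have b0 : 0 <= b by apply: modz_ge0; lia.
have bl : b < r * n%:Z by apply: ltz_pmod.
exists (i + n%:Z * (u * q) + a * n%:Z * s), (lo + b).
have -> : b = w - a * (r * n%:Z) by lia.
rewrite /w in e *; split.
- have -> : c = r * i + s * j + n%:Z * q * 1 by lia.
  by rewrite -uv; ring.
- by apply/dvdzP; exists (u * q + a * s); ring.
- by apply/dvdzP; exists (v * q - a * r); ring.
- by lia.
Qed.

(** [r x = m p - s y] lies strictly between [(m - s) p] and [m p]. *)
Lemma line_abscissa_bounds (p : nat) (r s m x y : int) :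
  0 < s -> s <= m <= r -> 0 < y < p%:Z -> r * x + s * y = m * p%:Z ->
  0 < x < p%:Z.
Proof.
move=> s0 mb yb e.
have ? : s * y < s * p%:Z by nia.
have ? : s * p%:Z <= m * p%:Z by nia.
have ? : m * p%:Z <= r * p%:Z by nia.
have ? : 0 < s * y by nia.
by apply/andP; split; nia.
Qed.

Lemma lattice_point_exists (p n : nat) (r s i j : int) :
  (0 < n)%N -> coprime n p -> 0 < s -> gcdz r s = 1 -> s + n%:Z <= r ->
  r * n%:Z < p%:Z -> exists x y : int, lattice_point p n r s i j x y.
Proof.
move=> n0 np s0 cop sr rn.
(* Starting the window at [s + 1] gives [s < m <= s + n <= r]. *)
have [m [mb /dvdzP[q mq]]] := line_level_exists (r * i + s * j) (s + 1) n0 np.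
have [x [y [e xi yj yb]]] := @line_point_exists n r s i j (m * p%:Z) 1 n0
  ltac:(lia) cop ltac:(by apply/dvdzP; exists q; lia).
have yp : 0 < y < p%:Z by lia.
exists x, y; split => //; last by rewrite e dvdz_mull.
by apply: line_abscissa_bounds e => //; lia.
Qed.

(** * Sumsets of abscissae of lattice points *)

(** Only abscissae are recorded, because the coset condition concerns [x] alone. *)
Definition lattice_sumset (p n : nat) (r s i j : int) (t : nat) : Prop :=
  exists U V : seq int, [/\ uniq U, uniq V, (t < size U)%N, (t < size V)%N
    & {in U & V, forall u v, exists y, lattice_point p n r s i j (u + v) y}].

Lemma progression_sumset (p n : nat) (r s i j x0 y0 gx gy : int) (t : nat) :
  gx != 0 ->
  (forall b : nat, (b <= 2 * t)%N ->
     lattice_point p n r s i j (x0 + b%:Z * gx) (y0 + b%:Z * gy)) ->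
  lattice_sumset p n r s i j t.
Proof.
move=> g0 pts.
have uq (z : int) : uniq [seq z + b%:Z * gx | b <- iota 0 t.+1].
  rewrite map_inj_uniq ?iota_uniq // => b b' /addrI /(mulIf g0) /eqP.
  by rewrite eqz_nat => /eqP.
exists [seq x0 + b%:Z * gx | b <- iota 0 t.+1], [seq 0 + b%:Z * gx | b <- iota 0 t.+1].
split; rewrite ?uq ?size_map ?size_iota //.
move=> _ _ /mapP[b + ->] /mapP[c + ->]; rewrite !mem_iota => bt ct.
exists (y0 + (b + c)%N%:Z * gy).
have -> : x0 + b%:Z * gx + (0 + c%:Z * gx) = x0 + (b + c)%N%:Z * gx.
  by rewrite PoszD; ring.
by apply: pts; lia.
Qed.

Lemma large_fiber (T S : finType) (f : T -> S) (t : nat) :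
  (t * #|S| < #|T|)%N -> exists c, (t < #|[set x | f x == c]|)%N.
Proof.
move=> tS; apply/existsP; apply: contraTT tS; rewrite negb_exists -leqNgt => /forallP small.
rewrite -sum1_card (partition_big f predT) //= mulnC -sum_nat_const.
by apply: leq_sum => c _; have := small c; rewrite -leqNgt cardsE sum1_card.
Qed.

(* Pigeonhole: the points (w, v) of a square lying in one fiber of r w + s v
   mod p differ by lattice vectors, and n times such a difference can be added
   to a central point without leaving the box. *)
Lemma central_sumset (p n q : nat) (r s i j x0 y0 : int) (t : nat) :
  prime p -> (0 < n)%N -> coprimez s p%:Z -> (t * p < q * q)%N ->
  (n * q)%N%:Z <= x0 <= p%:Z - (n * q)%N%:Z ->
  (n * q)%N%:Z <= y0 <= p%:Z - (n * q)%N%:Z ->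
  lattice_point p n r s i j x0 y0 -> lattice_sumset p n r s i j t.
Proof.
move=> pp n0 sp tq xb yb [_ _ /dvdzP[xi xiE] /dvdzP[yj yjE] /dvdzP[m mE]].
pose f (z : 'I_q * 'I_q) : 'F_p := (r * z.1%:Z + s * z.2%:Z)%:~R.
have [|c tc] := @large_fiber _ _ f t.
  by rewrite card_Fp // card_prod !card_ord.
set Z := [set z | f z == c] in tc.
have Zdvd z z' : z \in Z -> z' \in Z ->
    (p%:Z %| r * (z.1%:Z - z'.1%:Z) + s * (z.2%:Z - z'.2%:Z))%Z.
  rewrite !inE => /eqP zc /eqP z'c; rewrite (dvdz_pcharf (pchar_Fp pp)).
  suff -> : r * (z.1%:Z - z'.1%:Z) + s * (z.2%:Z - z'.2%:Z) =
     (r * z.1%:Z + s * z.2%:Z) - (r * z'.1%:Z + s * z'.2%:Z).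
    by rewrite rmorphB /= -/(f z) -/(f z') zc z'c subrr.
  by ring.
(* Equal first coordinates leave [p] dividing [s (v - v')] with [|v - v'| < q < p]. *)
have injZ : {in Z &, injective (fun z : 'I_q * 'I_q => z.1 : nat)}.
  move=> [w v] [w' v'] zZ z'Z /= ww.
  have := Zdvd _ _ zZ z'Z; rewrite /= ww subrr mulr0 add0r.
  rewrite mulrC Gauss_dvdzl 1?coprimez_sym // => /dvdzP[e eE].
  have vq := ltn_ord v; have vq' := ltn_ord v'.
  have e0 : e = 0 by nia.
  have vv : (v : nat) = v' by lia.
  by congr pair; apply: val_inj.
pose W := [seq (z.1 : nat)%:Z | z : 'I_q * 'I_q <- enum Z].
have uqW : uniq W.
  rewrite map_inj_in_uniq ?enum_uniq // => z z'; rewrite !mem_enum => zZ z'Z.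
  by move/eqP; rewrite eqz_nat => /eqP; apply: injZ.
have sW : size W = #|Z| by rewrite size_map -cardE.
have nn : n%:Z != 0 by lia.
exists [seq x0 + n%:Z * w | w <- W], [seq - (n%:Z * w) | w <- W].
rewrite !size_map -cardE; split => //.
- by rewrite map_inj_uniq // => w w' /addrI /(mulfI nn).
- by rewrite map_inj_uniq // => w w' /oppr_inj /(mulfI nn).
move=> _ _ /mapP[_ /mapP[z + ->] ->] /mapP[_ /mapP[z' + ->] ->].
rewrite !mem_enum => zZ z'Z.
have /dvdzP[e eE] := Zdvd _ _ zZ z'Z.
exists (y0 + n%:Z * (z.2%:Z - z'.2%:Z)).
have := ltn_ord z.1; have := ltn_ord z.2; have := ltn_ord z'.1; have := ltn_ord z'.2.
move: (z.1 : nat) (z.2 : nat) (z'.1 : nat) (z'.2 : nat) eE => a b c' d eE ? ? ? ?.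
have ? : (n * a <= n * q)%N by rewrite leq_mul2l; lia.
split.
- nia.
- nia.
- by apply/dvdzP; exists (xi + a%:Z - c'%:Z); lia.
- by apply/dvdzP; exists (yj + b%:Z - d%:Z); lia.
- apply/dvdzP; exists (m + n%:Z * e).
  have -> : (m + n%:Z * e) * p%:Z = m * p%:Z + n%:Z * (e * p%:Z) by ring.
  by rewrite -mE -eE; ring.
Qed.

(** * Central points and large sumsets *)

Lemma line_abscissa_central (p : nat) (r s m x y : int) :
  0 < r -> 0 < s -> r <= 13 * (m - s) -> 13 * m <= 12 * r ->
  0 < y < p%:Z -> r * x + s * y = m * p%:Z ->
  p%:Z <= 13 * x <= 12 * p%:Z.
Proof.
move=> r0 s0 m1 m2 yb e.
have ? : s * y < s * p%:Z by nia.
have ? : r * p%:Z <= 13 * (m - s) * p%:Z by nia.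
have ? : 13 * m * p%:Z <= 12 * r * p%:Z by nia.
have ? : 0 < s * y by nia.
by apply/andP; split; nia.
Qed.

Lemma ceil_multiple (c d : int) : 0 < c -> 0 <= d ->
  exists k : nat, d <= c * k%:Z < d + c.
Proof.
move=> c0 d0.
have e := divz_eq (d + c - 1) c.
have := ltz_pmod (d + c - 1) c0; have := @modz_ge0 (d + c - 1) c ltac:(lia).
move: e; set a := (_ %/ _)%Z; set b := (_ %% _)%Z => e ? ?.
have a0 : 0 <= a by nia.
by exists `|a|%N; rewrite gez0_abs //; apply/andP; split; lia.
Qed.

Lemma balanced_bezout (r s c : int) : 0 < r -> gcdz r s = 1 ->
  exists a b : int, r * a + s * b = c /\ 2 * `|b| <= r.
Proof.
move=> r0 cop.
have [u [v uv]] := @Bezoutz r s; rewrite cop in uv.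
have e := divz_eq (v * c) r.
have := ltz_pmod (v * c) r0; have := @modz_ge0 (v * c) r ltac:(lia).
move: e; set a := (_ %/ _)%Z; set b := (_ %% _)%Z => e b0 bl.
have ce : c = (u * r + v * s) * c by rewrite uv mul1r.
case: (lerP (2 * b) r) => br.
  by exists (u * c + s * a), b; split; [rewrite {2}ce; nia | lia].
by exists (u * c + s * (a + 1)), (b - r); split; [rewrite {2}ce; nia | lia].
Qed.

(** Since [n <= p / 1000], the floor [q] satisfies [n q >= 49 p / 650], just below [p / 13], and
    [190 (49 / 650)^2 > 1]. *)
Lemma cell_count (p n t : nat) : (0 < n)%N -> (1000 * n <= p)%N ->
  (190 * (n * n) * t <= p)%N -> (t * p < (p %/ (13 * n)) * (p %/ (13 * n)))%N.
Proof.
move=> n0 np pt; set q := (p %/ (13 * n))%N.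
have qe := divn_eq p (13 * n); rewrite -/q in qe.
have ql : (p %% (13 * n) < 13 * n)%N by rewrite ltn_mod; lia.
have l1 : (49 * p <= 650 * (n * q))%N by lia.
have l2 := leq_mul l1 l1.
have l3 : (190 * (n * n) * t * p <= p * p)%N by rewrite leq_mul2r pt orbT.
have p2 : (0 < p * p)%N by rewrite muln_gt0; lia.
have nn : (0 < n * n)%N by rewrite muln_gt0 n0.
rewrite -(ltn_pmul2l nn); clear - l2 l3 p2.
move: l2 l3 p2; have -> : (190 * (n * n) * t * p = 190 * (n * n * (t * p)))%N by ring.
have -> : (650 * (n * q) * (650 * (n * q)) = 650 * 650 * (n * n * (q * q)))%N by ring.
have -> : (49 * p * (49 * p) = 49 * 49 * (p * p))%N by ring.
by move: (n * n * (t * p))%N (n * n * (q * q))%N (p * p)%N => u v w; lia.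
Qed.

Lemma quartic_margin (p n : nat) :
  ((190 * (n * n)) * (190 * (n * n)) < p)%N ->
  (190 * (190 * (n * n)) <= p)%N /\ (1000 * n <= p)%N.
Proof.
move=> pn.
have l1 : (n <= n * n)%N by case: n {pn} => // n; rewrite leq_pmulr.
have l2 : (n * n <= (n * n) * (n * n))%N.
  by move: (n * n)%N => [|m] //; rewrite leq_pmulr.
by move: (n * n)%N l1 l2 pn => u; lia.
Qed.

Lemma central_line_sumset (p n : nat) (r s i j m x y : int) (t : nat) :
  prime p -> (2 <= n)%N -> 0 < r -> 0 < s -> coprimez s p%:Z ->
  ((190 * (n * n)) * (190 * (n * n)) < p)%N -> (190 * (n * n) * t <= p)%N ->
  r <= 13 * (m - s) -> 13 * m <= 12 * r ->
  p%:Z <= 13 * y <= 12 * p%:Z -> r * x + s * y = m * p%:Z ->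
  (n%:Z %| x - i)%Z -> (n%:Z %| y - j)%Z -> lattice_sumset p n r s i j t.
Proof.
move=> pp n2 r0 s0 sp pn pt m1 m2 yb e xi yj.
have p0 := prime_gt0 pp.
have xb := @line_abscissa_central p r s m x y r0 s0 m1 m2 ltac:(lia) e.
pose q := (p %/ (13 * n))%N.
have [_ np] := quartic_margin pn.
have qe := leq_trunc_div p (13 * n).
have {}xb : (n * q)%N%:Z <= x <= p%:Z - (n * q)%N%:Z by clear - xb qe; lia.
have {}yb' : (n * q)%N%:Z <= y <= p%:Z - (n * q)%N%:Z by clear - yb qe; lia.
apply: (@central_sumset p n q r s i j x y t) => //; first by lia.
- by apply: cell_count => //; lia.
- split=> //; try lia.
  by rewrite e dvdz_mull.
Qed.

Lemma lattice_sumset_exists (p n : nat) (r s i j : int) (t : nat) :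
  prime p -> (2 <= n)%N -> coprime n p -> 0 < s -> gcdz r s = 1 ->
  (n%:Z + 3) * s <= r -> r * n%:Z < p%:Z ->
  ((190 * (n * n)) * (190 * (n * n)) < p)%N -> (190 * (n * n) * t <= p)%N ->
  lattice_sumset p n r s i j t.
Proof.
move=> pp n2 np s0 cop sr rn pn pt.
have n0 : (0 < n)%N by lia.
have s5 : 5 * s <= r by clear - n2 sr s0; nia.
have r0 : 0 < r by lia.
have [qp _] := quartic_margin pn.
have rr : r <= r * n%:Z by clear - n0 r0; nia.
have sp : coprimez s p%:Z.
  rewrite coprimez_sym coprimezE absz_nat prime_coprime //.
  by apply/negP => /(dvdn_leq _); clear - s0 s5 rr rn; lia.
have level := line_level_exists (r * i + s * j).
have lineP m lo : (n%:Z %| m * p%:Z - (r * i + s * j))%Z -> exists x y : int,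
    [/\ r * x + s * y = m * p%:Z, (n%:Z %| x - i)%Z, (n%:Z %| y - j)%Z
      & lo <= y < lo + r * n%:Z].
  by move=> d; apply: line_point_exists => //; rewrite -addrA -opprD.
case: (lerP r (60 * n%:Z)) => r60.
  (* A single line r x + s y = m p already carries 2 t + 1 points. *)
  have [m [mb md]] := level p n (s + 1) n0 np.
  have [x [y [e xi yj yb]]] := lineP m 1 md.
  apply: (@progression_sumset p n r s i j x y (- (s * n%:Z)) (r * n%:Z)).
    by rewrite oppr_eq0 mulf_neq0; lia.
  move=> b bt.
  (* The first [y] is at most [60 n^2], and [2 t] steps of at most [60 n^2] add at most
     [120 p / 190]. *)
  have l1 : r * n%:Z <= 60 * (n * n)%N%:Z by clear - r60 n0; nia.
  have l2 : b%:Z * (r * n%:Z) <= b%:Z * (60 * (n * n)%N%:Z) by apply: ler_wpM2l.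
  have l3 : b%:Z * (60 * (n * n)%N%:Z) <= (2 * t)%N%:Z * (60 * (n * n)%N%:Z).
    by apply: ler_wpM2r; lia.
  have e' : r * (x + b%:Z * - (s * n%:Z)) + s * (y + b%:Z * (r * n%:Z)) = m * p%:Z.
    by rewrite -e; ring.
  have l4 : 0 <= b%:Z * (r * n%:Z) by rewrite !mulr_ge0 // ltW.
  have yb' : 0 < y + b%:Z * (r * n%:Z) < p%:Z.
    by clear - l1 l2 l3 l4 yb pt qp n0; lia.
  split => //.
  - by apply: line_abscissa_bounds e' => //; clear - mb sr s0; nia.
  - have -> : x + b%:Z * - (s * n%:Z) - i = x - i - b%:Z * s * n%:Z by ring.
    by rewrite rpredB // dvdz_mull.
  - have -> : y + b%:Z * (r * n%:Z) - j = y - j + b%:Z * r * n%:Z by ring.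
    by rewrite rpredD // dvdz_mull.
  - by rewrite e' dvdz_mull.
(* As s <= r / 5, the levels m between 18 r / 65 = r / 13 + r / 5 and 12 r / 13
   give abscissae in [p / 13, 12 p / 13]. *)
have [m [mb md]] := level p n ((18 * r + 64) %/ 65)%Z n0 np.
have {mb} [m1 m2] : 18 * r <= 65 * m /\ 65 * m <= 18 * r + 64 + 65 * n%:Z by lia.
pose Y := ((p%:Z + 12) %/ 13)%Z.
have [Y1 Y2] : p%:Z <= 13 * Y /\ 13 * Y <= p%:Z + 12 by rewrite /Y; clear; lia.
have [x [y [e xi yj yb]]] := lineP m Y md.
(* The window for [y] starts near [p / 13]; if its length [r n] is at most [11 p / 13], all of it is
   central. *)
case: (lerP (13 * (r * n%:Z)) (11 * p%:Z)) => rp.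
  by apply: (@central_line_sumset p n r s i j m x y t) => //;
    clear - m1 m2 s5 r60 n2 Y1 Y2 yb rp; lia.
(* Adding [n (a, b)] raises the level by [n] and keeps both residues mod [n]. *)
have [a [b [ab b2]]] := balanced_bezout p%:Z r0 cop.
case: (ltrP n%:Z (3 * `|b|)) => bn.
  (* Stepping by n (a, b) moves y by n b modulo r n; the arc of non-central
     values is shorter than M such steps and each step is too short to jump
     over the central arc, so a central point is reached. *)
  pose M := `|((3 * r) %/ (5 * n%:Z))%Z|%N.
  have [M1 M2] : 5 * (n%:Z * M%:Z) <= 3 * r /\ 3 * r <= 5 * (n%:Z * M%:Z) + 5 * n%:Z.
    have n5 : 0 < 5 * n%:Z by clear - n0; lia.
    have M0 : 0 <= ((3 * r) %/ (5 * n%:Z))%Z by rewrite divz_ge0 //; clear - r0; lia.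
    have := divz_eq (3 * r) (5 * n%:Z); have := ltz_pmod (3 * r) n5.
    have := modz_ge0 (3 * r) (lt0r_neq0 n5).
    rewrite /M (gez0_abs M0); move: (_ %/ _)%Z (_ %% _)%Z => u v.
    by clear; lia.
  (* The levels stay below [12 r / 13 = 60 r / 65]: [m] is about [18 r / 65 + n] at most,
     [n M <= 39 r / 65], and [r > 60 n] absorbs the rest. The integer [l] counts shifts along the
     line by [n (-s, r)]. *)
  have walk (k : nat) (l : int) : (k <= M)%N ->
      p%:Z <= 13 * (y + k%:Z * n%:Z * b + l * (r * n%:Z)) <= 12 * p%:Z ->
      lattice_sumset p n r s i j t.
    move=> kM yk; have nk : n%:Z * k%:Z <= n%:Z * M%:Z by apply: ler_wpM2l.
    have nk0 : 0 <= n%:Z * k%:Z by rewrite mulr_ge0.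
    apply: (@central_line_sumset p n r s i j (m + n%:Z * k%:Z)
      (x + k%:Z * n%:Z * a - l * (s * n%:Z)) (y + k%:Z * n%:Z * b + l * (r * n%:Z)) t) => //.
    - by clear - m1 s5 nk0; lia.
    - by clear - m2 M1 nk r60 n2; lia.
    - by rewrite mulrDl -e -ab; ring.
    - have -> : x + k%:Z * n%:Z * a - l * (s * n%:Z) - i =
        x - i + (k%:Z * a - l * s) * n%:Z by ring.
      by rewrite rpredD // dvdz_mull.
    - have -> : y + k%:Z * n%:Z * b + l * (r * n%:Z) - j =
        y - j + (k%:Z * b + l * r) * n%:Z by ring.
      by rewrite rpredD // dvdz_mull.
  case: (lerP (13 * y) (12 * p%:Z)) => y12.
    by apply: (walk 0%N 0) => //; clear - y12 yb Y1; lia.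
  (* As [n < 3 |b|], [n |b| M] exceeds [n^2 M / 3], which is about [r n / 5 > 11 p / 65]; the need
     is [10 p / 65], and the rounding error in [M] costs only order [n^2]. *)
  have bM : 2 * p%:Z <= 13 * (n%:Z * `|b| * M%:Z).
    have h1 : n%:Z * (5 * (n%:Z * M%:Z)) <= 3 * `|b| * (5 * (n%:Z * M%:Z)).
      by apply: ler_wpM2r; [rewrite !mulr_ge0 | apply: ltW].
    have h2 : n%:Z * (3 * r) <= n%:Z * (5 * (n%:Z * M%:Z) + 5 * n%:Z).
      by apply: ler_wpM2l.
    by clear - h1 h2 rp qp; move: `|b| h1 => c h1; lia.
  have nb0 : 0 < n%:Z * `|b| by apply: mulr_gt0 => //; clear - bn; lia.
  have nb2 : 2 * (n%:Z * `|b|) < p%:Z.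
    have : n%:Z * (2 * `|b|) <= n%:Z * r by apply: ler_wpM2l.
    by clear - rn; lia.
  (* Moving up, [y] passes the end of the window and is brought back by [r n] ([l = -1]); moving
     down, it falls below [12 p / 13] directly ([l = 0]). *)
  case: (lerP 0 b) => bs.
    have babs : `|b| = b by rewrite ger0_norm.
    have [k kb] := @ceil_multiple (n%:Z * b) (Y + r * n%:Z - y)
      ltac:(by rewrite -babs) ltac:(clear - yb; lia).
    rewrite babs in bM nb0 nb2.
    apply: (walk k (-1)); last by clear - kb nb2 Y1 Y2; lia.
    have : n%:Z * b * k%:Z < n%:Z * b * (M%:Z + 1).
      by clear - kb bM y12 Y2 rn; lia.
    by rewrite ltr_pM2l //; clear; lia.
  have babs : `|b| = - b by rewrite ltr0_norm.
  rewrite babs in bM nb0 nb2.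
  pose G := ((12 * p%:Z) %/ 13)%Z.
  have [G1 G2] : 13 * G <= 12 * p%:Z /\ 12 * p%:Z <= 13 * G + 12 by rewrite /G; clear; lia.
  have [k kb] := @ceil_multiple (n%:Z * - b) (y - G) nb0 ltac:(clear - y12 G1; lia).
  apply: (walk k 0); last by clear - kb nb2 G1 G2; lia.
  have : n%:Z * - b * k%:Z < n%:Z * - b * (M%:Z + 1).
    by clear - kb bM yb G2 Y2 rn; lia.
  by rewrite ltr_pM2l //; clear; lia.
(* Here the vector n (a, b) is short, and its multiples form the progression,
   directed by g so that y moves towards p / 2. *)
have sb : 15 * (s * `|b|) <= r * n%:Z.
  have : 5 * s * (3 * `|b|) <= r * n%:Z.
    by apply: ler_pM => //; rewrite mulr_ge0 // ltW.
  by clear; lia.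
have sb' : `|s * b| = s * `|b| by rewrite normrM gtr0_norm.
have a0 : 0 < a by rewrite -(pmulr_rgt0 a r0); clear - ab sb sb' rn; lia.
(* [r a = p - s b], where [p < 13 r n / 11] and [|s b| <= r n / 15]. *)
have a2 : a <= 2 * n%:Z.
  by rewrite -(ler_pM2l r0); clear - ab sb sb' rp rn; lia.
(* The point is chosen afresh with [y] in the window starting at 1: only [x] has to be central
   now. *)
move: x y e xi yj yb => _ _ _ _ _ _.
have [x [y [e xi yj yb]]] := lineP m 1 md.
have xb := @line_abscissa_central p r s m x y r0 s0 ltac:(clear - m1 s5; lia)
  ltac:(clear - m2 r60 n2; lia) ltac:(clear - yb rn; lia) e.
have [g [g1 gb]] : exists g : int, (g = 1 \/ g = -1) /\
    (2 * y <= p%:Z /\ 0 <= g * b \/ p%:Z <= 2 * y /\ g * b <= 0).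
  case: (lerP (2 * y) p%:Z) => y2; case: (lerP 0 b) => b0.
  - by exists 1; clear - y2 b0; lia.
  - by exists (-1); clear - y2 b0; lia.
  - by exists (-1); clear - y2 b0; lia.
  - by exists 1; clear - y2 b0; lia.
apply: (@progression_sumset p n r s i j x y (g * (n%:Z * a)) (g * (n%:Z * b))).
  by apply: mulf_neq0; [clear - g1; lia | apply: mulf_neq0; clear - n0 a0; lia].
move=> k kt.
have l1' : 0 <= n%:Z * a by rewrite mulr_ge0 // ltW.
have l1 : k%:Z * (n%:Z * a) <= (2 * t)%N%:Z * (2 * (n * n)%N%:Z).
  apply: ler_pM => //.
  by have := ler_wpM2l (ltW (n0 : 0 < n%:Z)) a2; clear; lia.
have l2 : 3 * (k%:Z * (n%:Z * `|b|)) <= (2 * t)%N%:Z * (n * n)%N%:Z.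
  have : k%:Z * (n%:Z * (3 * `|b|)) <= (2 * t)%N%:Z * (n%:Z * n%:Z).
    by apply: ler_pM => //; apply: ler_wpM2l.
  by clear; lia.
have gn : `|g| = 1 by case: g1 => ->.
have l3 : `|k%:Z * (g * (n%:Z * b))| = k%:Z * (n%:Z * `|b|).
  by rewrite !normrM gn mul1r.
have l4 : `|k%:Z * (g * (n%:Z * a))| = k%:Z * (n%:Z * a).
  by rewrite !normrM gn mul1r (gtr0_norm a0).
split.
- by clear - xb l1 l4 pt qp n0; lia.
- case: gb => -[y2 gb].
    have h : 0 <= k%:Z * (n%:Z * (g * b)) by rewrite mulr_ge0 // mulr_ge0.
    by clear - h gb y2 yb l2 l3 pt qp n0; lia.
  have h : 0 <= k%:Z * (n%:Z * - (g * b)) by rewrite mulr_ge0 // mulr_ge0 // oppr_ge0.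
  by clear - h gb y2 yb l2 l3 pt qp n0 rn; lia.
- have -> : x + k%:Z * (g * (n%:Z * a)) - i = x - i + k%:Z * g * a * n%:Z by ring.
  by rewrite rpredD // dvdz_mull.
- have -> : y + k%:Z * (g * (n%:Z * b)) - j = y - j + k%:Z * g * b * n%:Z by ring.
  by rewrite rpredD // dvdz_mull.
- have -> : r * (x + k%:Z * (g * (n%:Z * a))) + s * (y + k%:Z * (g * (n%:Z * b)))
    = (m + k%:Z * g * n%:Z) * p%:Z by rewrite mulrDl -e -ab; ring.
  by rewrite dvdz_mull.
Qed.

(** * Roots of unity and lattice points in a coset *)

(** The unit group is cyclic, so it has an element of order the gcd, all of whose powers are
    roots. *)
Lemma card_unity_roots (F : finFieldType) (e : nat) : (0 < e)%N ->
  (gcdn e #|F|.-1 <= #|[set x : F | (x ^+ e == 1)%R]|)%N.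
Proof.
move=> e0; set d := gcdn _ _.
have q0 : (0 < #|F|.-1)%N by rewrite -subn1 subn_gt0 finNzRing_gt1.
have unity (x : F) : x != 0 -> x ^+ #|F|.-1 = 1.
  by move=> x0; apply: (mulfI x0); rewrite -exprS (ltn_predK (finNzRing_gt1 F)) expf_card mulr1.
have /hasP[w _ w_prim] : has #|F|.-1.-primitive_root (enum (predC1 (0 : F))).
  apply: has_prim_root => //.
  - by apply/allP => x; rewrite mem_enum inE => x0; apply/unity_rootP/unity.
  - exact: enum_uniq.
  - by rewrite -cardE cardC1.
have d_prim := dvdn_prim_root w_prim (dvdn_gcdr e _ : d %| #|F|.-1)%N.
set v := w ^+ _ in d_prim.
have injv : injective (fun b : 'I_d => v ^+ b).
  move=> b c /eqP; rewrite (eq_prim_root_expr d_prim) => /eqP.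
  by rewrite !modn_small // => /val_inj.
rewrite -[X in (X <= _)%N]card_ord -(card_imset _ injv); apply: subset_leq_card.
apply/fintype.subsetP => _ /imsetP[b _ ->]; rewrite inE -exprM.
have /dvdnP[m ->] := dvdn_gcdl e #|F|.-1.
by rewrite -/d mulnA mulnC exprM (prim_expr_order d_prim) expr1n.
Qed.

(** Reduction mod [p] is injective on [U] and [V], each having a translate inside [(0, p)], so the
    incidence bound applies to their images. *)
Lemma sumset_coset_point (p n : nat) (r s i j : int) (t e : nat) (z : 'F_p) :
  prime p -> (0 < e)%N -> z != 0 -> lattice_sumset p n r s i j t ->
  (p ^ 3 < gcdn e (p - 1) ^ 2 * (t.+1 * t.+1))%N ->
  exists (x y : int) (h : 'F_p),
    [/\ lattice_point p n r s i j x y, x%:~R = z * h & h ^+ e = 1].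
Proof.
move=> pp e0 z0 [U [V [uqU uqV tU tV UV]]] big.
have [u0 u0U] : exists u, u \in U by case: U tU {uqU UV} => // u U; exists u; rewrite mem_head.
have [v0 v0V] : exists v, v \in V by case: V tV {uqV UV} => // v V; exists v; rewrite mem_head.
have small (a b : int) : 0 < a < p%:Z -> 0 < b < p%:Z -> (p%:Z %| a - b)%Z -> a = b.
  by move=> ab bb /dvdzP[m]; case: (ltgtP m 0) => m0; nia.
pose img (S : seq int) : {set 'F_p} := [set x in [seq u%:~R : 'F_p | u <- S]].
have card_img (S : seq int) : uniq S ->
    {in S &, forall a b, (p%:Z %| a - b)%Z -> a = b} -> #|img S| = size S.
  move=> uqS inj; rewrite cardsE (card_uniqP _) ?size_map //.
  rewrite map_inj_in_uniq // => a b aS bS /eqP ab; apply: inj => //.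
  by rewrite (dvdz_pcharf (pchar_Fp pp)) rmorphB subr_eq0.
have injU : {in U &, forall a b, (p%:Z %| a - b)%Z -> a = b}.
  move=> a b aU bU ab; apply: (addIr v0).
  have [y [ay _ _ _ _]] := UV _ _ aU v0V; have [y' [by' _ _ _ _]] := UV _ _ bU v0V.
  by apply: small => //; have -> : a + v0 - (b + v0) = a - b by ring.
have injV : {in V &, forall a b, (p%:Z %| a - b)%Z -> a = b}.
  move=> a b aV bV ab; apply: (addrI u0).
  have [y [ay _ _ _ _]] := UV _ _ u0U aV; have [y' [by' _ _ _ _]] := UV _ _ u0U bV.
  by apply: small => //; have -> : u0 + a - (u0 + b) = a - b by ring.
pose H := [set h : 'F_p | h ^+ e == 1].
have HP h : reflect (h ^+ e = 1) (h \in H) by rewrite inE; apply: eqP.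
have [] := @sumset_meets_coset _ H (img U) (img V) z z0.
- by apply/HP; rewrite expr0n; case: e e0 {big H HP} => // e _ /eqP; rewrite eq_sym oner_eq0.
- by move=> g h /HP g1 /HP h1; apply/HP; rewrite exprMn g1 h1 mulr1.
- by move=> g /HP g1; apply/HP; rewrite exprVn g1 invr1.
- rewrite !card_img // card_Fp //; apply: (leq_trans big); apply: leq_mul; last exact: leq_mul.
  rewrite leq_exp2r //; have := @card_unity_roots 'F_p e e0.
  by rewrite card_Fp // subn1.
move=> u [v [h []]]; rewrite !inE => /mapP[u' uU ->] /mapP[v' vV ->] hH e'.
have [y xy] := UV _ _ uU vV.
by exists (u' + v'), y, h; split => //; [rewrite rmorphD | apply/eqP].
Qed.

(** The reflection [x -> p - x] flips the sign of [r], which reduces negative [r] to positive. *)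
Lemma lattice_point_reflect (p n : nat) (r s i j x y : int) :
  lattice_point p n (- r) s (p%:Z - i) j x y ->
  lattice_point p n r s i j (p%:Z - x) y.
Proof.
move=> [xb yb xi yj /dvdzP[m mE]]; split => //.
- by clear - xb; lia.
- by rewrite -rpredN; have -> : - (p%:Z - x - i) = x - (p%:Z - i) by ring.
- by apply/dvdzP; exists (r + m); rewrite mulrDl -mE; ring.
Qed.

Lemma lattice_sumset_reflect (p n : nat) (r s i j : int) (t : nat) :
  lattice_sumset p n (- r) s (p%:Z - i) j t -> lattice_sumset p n r s i j t.
Proof.
move=> [U [V [uqU uqV tU tV UV]]].
exists [seq p%:Z - u | u <- U], [seq - v | v <- V]; rewrite !size_map; split => //.
- by rewrite map_inj_uniq // => a b /addrI /oppr_inj.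
- by rewrite map_inj_uniq //; apply: oppr_inj.
move=> _ _ /mapP[u uU ->] /mapP[v vV ->]; have [y xy] := UV _ _ uU vV.
exists y; rewrite -addrA -opprD; exact: lattice_point_reflect.
Qed.

Lemma coset_lattice_point (p n : nat) (r s i j : int) (e : nat) (z : 'F_p) :
  prime p -> (2 <= n)%N -> 0 < s -> gcdz r s = 1 ->
  (n%:Z + 3) * s <= `|r| -> `|r| * n%:Z <= p%:Z -> z != 0 ->
  ((190 * (n * n)) * (190 * (n * n)) * p <= gcdn e (p - 1) ^ 2)%N \/ e = 0%N ->
  exists (x y : int) (h : 'F_p),
    [/\ lattice_point p n r s i j x y, x%:~R = z * h & h ^+ e = 1].
Proof.
move=> pp n2 s0 cop sr rn z0 ecase.
have p1 := prime_gt1 pp.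
have ns : n%:Z + 3 <= (n%:Z + 3) * s by clear - s0; nia.
have r1 : 1 < `|r| by clear - ns sr; lia.
have nn : n%:Z + n%:Z <= `|r| * n%:Z by clear - r1; nia.
have np : coprime n p.
  rewrite coprime_sym prime_coprime //; apply/negP => /(dvdn_leq _).
  by clear - nn rn n2; lia.
have {}rn : `|r| * n%:Z < p%:Z.
  rewrite lt_neqAle rn andbT; apply/eqP => rp.
  have : (n %| p)%N by apply/dvdnP; exists `|r|%N; lia.
  move/gcdn_idPl => g; move: np; rewrite /coprime g; by clear - n2; lia.
have snr : s + n%:Z <= `|r| by clear - ns sr s0 n2; nia.
(* For [e = 0], the case [k = 1], the condition on [h] is empty and any lattice point serves, with
   [h = x / z]. *)
have [-> |e0] := posnP e.
  have finish (x y : int) : lattice_point p n r s i j x y -> exists (x y : int) (h : 'F_p),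
      [/\ lattice_point p n r s i j x y, x%:~R = z * h & h ^+ 0 = 1].
    by move=> xy; exists x, y, (x%:~R / z); rewrite mulrC divfK.
  case: (lerP 0 r) => rs.
    rewrite ger0_norm // in snr rn.
    have [x [y xy]] := @lattice_point_exists p n r s i j ltac:(lia) np s0 cop snr rn.
    exact: finish xy.
  rewrite ltr0_norm // in snr rn.
  have cop' : gcdz (- r) s = 1 by rewrite gcdNz.
  have [x [y xy]] := @lattice_point_exists p n (- r) s (p%:Z - i) j ltac:(lia) np s0 cop' snr rn.
  exact: finish (lattice_point_reflect xy).
case: ecase => [big|e00]; last by rewrite e00 in e0.
set c := (190 * (n * n))%N in big.
have c0 : (0 < c)%N by rewrite !muln_gt0 (ltnW n2).
have dp : (gcdn e (p - 1) < p)%N.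
  by have := dvdn_leq _ (dvdn_gcdr e (p - 1)); clear - p1; lia.
(* The gcd is below [p], so [c^2 p] is below [p^2]. *)
have pn : (c * c < p)%N.
  rewrite -(ltn_pmul2r (prime_gt0 pp)); apply: (leq_ltn_trans big).
  by rewrite expnS expn1 ltn_mul.
pose t := (p %/ c)%N.
have ct : (c * t <= p)%N by rewrite mulnC leq_trunc_div.
have ct1 : (p < c * t.+1)%N by rewrite mulnC ltn_ceil.
apply: (@sumset_coset_point p n r s i j t e z) => //.
  case: (lerP 0 r) => rs.
    rewrite ger0_norm // in sr rn.
    exact: lattice_sumset_exists.
  rewrite ltr0_norm // in sr rn.
  apply: lattice_sumset_reflect; apply: lattice_sumset_exists => //.
  by rewrite gcdNz.
(* [c (t + 1) > p] gives [c^2 p (t + 1)^2 > p^3]. *)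
apply: (@leq_trans (c * c * p * (t.+1 * t.+1))); last by rewrite leq_mul2r big orbT.
have : (p * p < c * t.+1 * (c * t.+1))%N by apply: ltn_mul.
rewrite -(ltn_pmul2r (prime_gt0 pp)).
have -> : (c * c * p * (t.+1 * t.+1) = c * t.+1 * (c * t.+1) * p)%N by ring.
by have -> : (p ^ 3 = p * p * p)%N by ring.
Qed.

(** * Numerical bounds *)

Lemma expR2_le10 (R : realType) : expR 2 <= 10 :> R.
Proof.
(* exp (-1/4) >= 3/4 and (4/3)^8 < 10 *)
have e4 : expR 4^-1 <= 4 / 3 :> R.
  have := expR_ge1Dx (- 4^-1 : R); rewrite expRN.
  have e0 := expR_gt0 (4^-1 : R).
  move=> h; have : (1 - 4^-1) * expR 4^-1 <= 1 :> R by rewrite -ler_pdivlMr // div1r.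
  by lra.
have -> : 2 = 8%:R * 4^-1 :> R by lra.
rewrite expRM_natl; apply: (@le_trans _ _ ((4 / 3) ^+ 8)); last by lra.
by rewrite ler_pXn2r // nnegrE ?expR_ge0 //; lra.
Qed.

Lemma ln_ge12 (R : realType) (x : R) : 10 ^+ 6 < x -> 12 <= ln x.
Proof.
move=> x6.
have t0 : 0 < 10 :> R by [].
have l10 : 2 <= ln (10 : R).
  by rewrite -[X in X <= _]expRK ler_ln ?posrE ?expR_gt0 // expR2_le10.
have x0 : 0 < x by apply: lt_trans x6; apply: exprn_gt0.
have : ln ((10 : R) ^+ 6) <= ln x by rewrite ler_ln ?posrE ?exprn_gt0 // ltW.
by rewrite lnXn // -[ln 10 *+ 6]mulr_natl => h; lra.
Qed.

Lemma subgroup_order_bound (R : realType) (p n d : nat) :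
  (10 : R) ^+ 6 < p%:R ->
  (132%:R / 100%:R : R) * n%:R ^+ 2 * Num.sqrt p%:R * ln p%:R ^+ 2 <= d%:R ->
  ((190 * (n * n)) * (190 * (n * n)) * p <= d ^ 2)%N.
Proof.
move=> p6 dn; have l12 := ln_ge12 p6.
have l144 : 144 <= ln p%:R ^+ 2 :> R by nra.
have c0 : 0 <= n%:R ^+ 2 * Num.sqrt p%:R :> R by rewrite mulr_ge0 ?sqr_ge0 ?sqrtr_ge0.
have dd : 190 * (n%:R ^+ 2 * Num.sqrt p%:R) <= d%:R :> R.
  by apply: le_trans dn; nra.
rewrite -(ler_nat R) natrX !natrM.
have {}dd : (190 * (n%:R ^+ 2 * Num.sqrt p%:R)) ^+ 2 <= d%:R ^+ 2 :> R.
  by rewrite ler_pXn2r // nnegrE ?mulr_ge0.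
apply: le_trans dd; rewrite !exprMn sqr_sqrtr //; lra.
Qed.

(** * From lattice points to values of the power map *)

Lemma ndvdz_small (d m : int) : 0 < m < d -> ~~ (d %| m)%Z.
Proof. by move=> mb; apply/negP => /dvdz_mod0P; rewrite modz_small; lia. Qed.

Local Open Scope classical_set_scope.
Local Open Scope ring_scope.

Lemma power_map_hits (p n : nat) (A : int) (k i j : nat) (x y : int) :
  prime p -> 0 < x < p%:Z -> 0 < y < p%:Z ->
  (n%:Z %| x - i%:Z)%Z -> (n%:Z %| y - j%:Z)%Z ->
  A%:~R * x%:~R ^+ k = y%:~R :> 'F_p ->
  (power_map p A k @` residue_class p n i) `&` residue_class p n j !=set0.
Proof.
move=> pp xb yb xi yj e; exists y; split.
  exists x; first by split; [lia | apply/eqP; rewrite eqz_mod_dvd].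
  rewrite /power_map -[RHS](@modz_small y p%:Z); last by lia.
  apply/eqP; rewrite eqz_mod_dvd (dvdz_pcharf (pchar_Fp pp)).
  by rewrite rmorphB rmorphM rmorphXn /= e subrr.
by split; [lia | apply/eqP; rewrite eqz_mod_dvd].
Qed.

Theorem theorem3p2 (R : realType) (p n : nat) (A : int) (k : nat)
    (p_prime : prime p) (p_odd : odd p) (n_ge2 : (2 <= n)%N)
    (A_small : abs_least p A) (pNdvdA : ~~ (p%:Z %| A)%Z)
    (k_bounds : (1 <= k < p - 1)%N) (k_coprime : gcdn k (p - 1) = 1%N)
    (C_good : exists2 C : int, multiplier_set p A k C &
       exists2 E : int, E = C \/ abs_least_inverse p C E & good_fraction p n E)
    (size_cond :
       ((10 : R) ^+ 6 < p%:R /\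
        (132%:R / 100%:R : R) * n%:R ^+ 2 * Num.sqrt p%:R * ln p%:R ^+ 2
          <= (gcdn (k - 1) (p - 1))%:R)
       \/ k = 1%N) :
  forall i j : nat, (i <= n - 1)%N -> (j <= n - 1)%N ->
    (power_map p A k @` residue_class p n i) `&` residue_class p n j !=set0.
Proof.
move=> i j _ _.
have pch := pchar_Fp p_prime.
have intr_eq (a b : int) : (a = b %[mod p%:Z])%Z -> a%:~R = b%:~R :> 'F_p.
  move/eqP; rewrite eqz_mod_dvd (dvdz_pcharf pch) rmorphB subr_eq0.
  by move/eqP.
case: C_good => C [_ [w [wb CA]]] [E EC [t [r [s [Ers s0 cop sr rn]]]]].
have n0 : (0 < n)%N by lia.
have {}rn : `|r| * n%:Z <= p%:Z.
  move: rn; rewrite ler_pdivlMr ?ltr0z // => rn.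
  by rewrite -(ler_int rat) rmorphM.
have {}Ers : E * s = t * p%:Z - r.
  have s0' : s%:Q != 0 by rewrite intr_eq0; lia.
  by apply/eqP; rewrite -(eqr_int rat) rmorphM /= Ers divfK.
have ecase : ((190 * (n * n)) * (190 * (n * n)) * p <= gcdn (k - 1) (p - 1) ^ 2)%N
    \/ (k - 1 = 0)%N.
  by case: size_cond => [[p6 dn]|->]; [left; apply: subgroup_order_bound dn | right].
have w0 : w%:~R != 0 :> 'F_p.
  by rewrite -(dvdz_pcharf pch) ndvdz_small //; clear - wb; lia.
have a0 : A%:~R != 0 :> 'F_p by rewrite -(dvdz_pcharf pch).
have {CA} c_def : C%:~R = A%:~R * w%:~R ^+ (k - 1) :> 'F_p.
  by rewrite (intr_eq _ _ CA) rmorphM rmorphXn.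
have c0 : C%:~R != 0 :> 'F_p by rewrite c_def mulf_neq0 ?expf_neq0.
have s0F : s%:~R != 0 :> 'F_p.
  rewrite -(dvdz_pcharf pch) ndvdz_small // s0 /=.
  by clear - sr rn s0 n_ge2; nia.
(* Mod [p], [s E = - r], so [r x + s y = 0] reads [s y = s E x]. *)
have on_graph x y (i' j' : int) : lattice_point p n r s i' j' x y ->
    y%:~R = E%:~R * x%:~R :> 'F_p.
  move=> [_ _ _ _]; rewrite (dvdz_pcharf pch) rmorphD !rmorphM /= => /eqP e.
  apply: (mulfI s0F); rewrite mulrA -[s%:~R * E%:~R]rmorphM /= [s * E]mulrC Ers.
  rewrite rmorphB rmorphM /= -[p%:Z%:~R]/(p%:R) pchar_Fp_0 // mulr0 sub0r mulNr.
  by apply/eqP; rewrite -subr_eq0 opprK addrC; apply/eqP.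
have linear x (h : 'F_p) : x%:~R = w%:~R * h -> h ^+ (k - 1) = 1 ->
    A%:~R * x%:~R ^+ k = C%:~R * x%:~R :> 'F_p.
  move=> xh h1; have -> : k = (k - 1).+1 by lia.
  by rewrite exprSr mulrA c_def xh exprMn h1 mulr1.
case: EC => [EC|[_ CE]].
  have [x [y [h [xy xh h1]]]] := @coset_lattice_point p n r s i j (k - 1) _
    p_prime n_ge2 s0 cop sr rn w0 ecase.
  case: (xy) => xb yb xi yj _; apply: (power_map_hits p_prime xb yb xi yj).
  by rewrite (linear _ _ xh h1) (on_graph _ _ _ _ xy) EC.
have {}CE : C%:~R * E%:~R = 1 :> 'F_p by rewrite -intrM (intr_eq _ _ CE).
(* For [E] inverse to [C] the coordinates swap: [y] is sought in the coset of [C w], which puts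
   [x = E y] in the coset of [w]. *)
have [y [x [h [yx yh h1]]]] := @coset_lattice_point p n r s j i (k - 1) _
  p_prime n_ge2 s0 cop sr rn (mulf_neq0 c0 w0) ecase.
have xE := on_graph _ _ _ _ yx.
case: (yx) => yb xb yj xi _; apply: (power_map_hits p_prime xb yb xi yj).
rewrite (linear x h) // xE ?mulrA ?CE ?mul1r // yh.
by rewrite !mulrA [E%:~R * _]mulrC CE mul1r.
Qed.
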